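(* Let $\mathcal{G}_1, \mathcal{G}_2$ be effective ample Hausdorff groupoids whose unit spaces $\mathcal{G}_1^{(0)}, \mathcal{G}_2^{(0)}$ are locally compact Cantor spaces. Suppose that for $i=1,2$ every $\mathcal{G}_i$-orbit has at least $3$ elements, and every non-empty clopen subset of $\mathcal{G}_i^{(0)}$ contains at least two distinct points of some single $\mathcal{G}_i$-orbit. Then every group isomorphism $\Phi\colon \llbracket \mathcal{G}_1\rrbracket \to \llbracket \mathcal{G}_2\rrbracket$ is spatial, i.e.\ there is a homeomorphism $\phi\colon \mathcal{G}_1^{(0)}\to\mathcal{G}_2^{(0)}$ with $\Phi(\gamma)=\phi\circ\gamma\circ\phi^{-1}$ for all $\gamma\in\llbracket \mathcal{G}_1\rrbracket$. In particular, the following are equivalent: (1) $\mathcal{G}_1 \cong \mathcal{G}_2$ as topological groupoids; (2) $\llbracket \mathcal{G}_1 \rrbracket \cong \llbracket \mathcal{G}_2 \rrbracket$ as abstract groups.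
   Context: A locally compact Cantor space is a non-empty second countable Hausdorff space with a basis of compact open sets and no isolated points. An étale groupoid is a topological groupoid $\mathcal{G}$ whose range map $r(g)=gg^{-1}$ (and source map $s(g)=g^{-1}g$) is a local homeomorphism; $\mathcal{G}^{(0)}$ is its unit space. $\mathcal{G}$ is ample if it is étale and $\mathcal{G}^{(0)}$ is Hausdorff with a basis of compact open sets; effective if the interior of $\{g: s(g)=r(g)\}$ equals $\mathcal{G}^{(0)}$. The $\mathcal{G}$-orbit of $x$ is $\{r(g): s(g)=x\}$. A bisection is an open $U\subseteq\mathcal{G}$ on which $s,r$ are injective; it is full if $s(U)=r(U)=\mathcal{G}^{(0)}$; $\pi_U=r|_U\circ(s|_U)^{-1}$. The support of a homeomorphism is the closure of the set of points it moves. The topological full group $\llbracket\mathcal{G}\rrbracket$ is the group of all homeomorphisms $\pi_U$ of $\mathcal{G}^{(0)}$ with $U$ a full bisection and $\operatorname{supp}(\pi_U)$ compact. *)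

(* Defs.v *)
From HB Require Import structures.
From mathcomp Require Import all_boot all_order all_algebra.
From mathcomp Require Import all_classical all_reals all_analysis.

Set Implicit Arguments.
Unset Strict Implicit.
Unset Printing Implicit Defensive.

Local Open Scope classical_set_scope.

Definition second_countable (X : topologicalType) : Prop :=
  exists B : set (set X), countable B /\ (forall V, B V -> open V) /\
    (forall W x, open W -> W x -> exists2 V, B V & V x /\ V `<=` W).

Definition compact_open_basis (X : topologicalType) : Prop :=
  forall W x, open W -> W x -> exists V : set X, [/\ compact V, open V, V x & V `<=` W].

Definition no_isolated_points (X : topologicalType) : Prop :=
  forall x : X, ~ open [set x].

Definition lc_cantor_space (X : topologicalType) : Prop :=
  [/\ (exists x : X, True), second_countable X, hausdorff_space X,
      compact_open_basis X & no_isolated_points X].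

Definition local_homeo (A B : topologicalType) (f : A -> B) : Prop :=
  continuous f /\
  forall a, exists U : set A, [/\ open U, U a, {in U &, injective f} &
      (forall V, open V -> V `<=` U -> open (f @` V))].

Definition homeomorphism (A B : topologicalType) (f : A -> B) : Prop :=
  exists g : B -> A, [/\ cancel f g, cancel g f, continuous f & continuous g].

(* A topological groupoid with arrow space G and unit space X.  The unit space
   G^(0) is the image of the unit map [gunit : X -> G]; since [gs] is continuous
   and [gs \o gunit = id], [gunit] is a homeomorphism of X onto G^(0) with the
   subspace topology.  Source and range are [gunit \o gs] and [gunit \o gr]. *)
Record groupoid (G X : topologicalType) := Groupoid {
  gs : G -> X;
  gr : G -> X;
  gunit : X -> G;
  ginv : G -> G;
  gmul : G -> G -> G;
  gs_unit : forall x, gs (gunit x) = x;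
  gr_unit : forall x, gr (gunit x) = x;
  gs_mul : forall g h, gs g = gr h -> gs (gmul g h) = gs h;
  gr_mul : forall g h, gs g = gr h -> gr (gmul g h) = gr g;
  gmulA : forall g h k, gs g = gr h -> gs h = gr k ->
     gmul (gmul g h) k = gmul g (gmul h k);
  gmul_unitl : forall g, gmul (gunit (gr g)) g = g;
  gmul_unitr : forall g, gmul g (gunit (gs g)) = g;
  gs_inv : forall g, gs (ginv g) = gr g;
  gr_inv : forall g, gr (ginv g) = gs g;
  gmulV : forall g, gmul g (ginv g) = gunit (gr g);
  gmulVl : forall g, gmul (ginv g) g = gunit (gs g);
  gs_cont : continuous gs;
  gr_cont : continuous gr;
  gunit_cont : continuous gunit;
  ginv_cont : continuous ginv;
  gmul_cont : {within [set p : G * G | gs p.1 = gr p.2],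
                continuous (fun p : G * G => gmul p.1 p.2)}
}.

Section GroupoidNotions.
Variables (G X : topologicalType) (GG : groupoid G X).

Definition etale : Prop := local_homeo (gr GG) /\ local_homeo (gs GG).

Definition ample : Prop := etale /\ hausdorff_space X /\ compact_open_basis X.

Definition hausdorff_groupoid : Prop := hausdorff_space G.

Definition effective : Prop :=
  interior [set g | gs GG g = gr GG g] = range (gunit GG).

Definition orbit (x : X) : set X := [set gr GG g | g in [set g | gs GG g = x]].

Definition bisection (U : set G) : Prop :=
  open U /\ {in U &, injective (gs GG)} /\ {in U &, injective (gr GG)}.

Definition full_bisection (U : set G) : Prop :=
  bisection U /\ gs GG @` U = setT /\ gr GG @` U = setT.

Definition is_pi (U : set G) (f : X -> X) : Prop :=
  forall g, U g -> f (gs GG g) = gr GG g.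

Definition support (f : X -> X) : set X := closure [set x | f x != x].

Definition full_group : set (X -> X) :=
  [set f | exists U, [/\ full_bisection U, is_pi U f & compact (support f)]].

End GroupoidNotions.

Definition groupoid_isomorphic (G1 X1 G2 X2 : topologicalType)
  (GG1 : groupoid G1 X1) (GG2 : groupoid G2 X2) : Prop :=
  exists (F : G1 -> G2) (f : X1 -> X2),
    [/\ homeomorphism F, homeomorphism f,
        (forall g, gs GG2 (F g) = f (gs GG1 g)),
        (forall g, gr GG2 (F g) = f (gr GG1 g)) &
        (forall g h, gs GG1 g = gr GG1 h -> F (gmul GG1 g h) = gmul GG2 (F g) (F h))].

Definition full_group_iso (G1 X1 G2 X2 : topologicalType)
  (GG1 : groupoid G1 X1) (GG2 : groupoid G2 X2) (Phi : (X1 -> X1) -> (X2 -> X2)) : Prop :=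
  [/\ (forall a, full_group GG1 a -> full_group GG2 (Phi a)),
      {in full_group GG1 &, injective Phi},
      (forall b, full_group GG2 b -> exists2 a, full_group GG1 a & Phi a = b) &
      (forall a b, full_group GG1 a -> full_group GG1 b -> Phi (a \o b) = Phi a \o Phi b)].

Definition full_groups_isomorphic (G1 X1 G2 X2 : topologicalType)
  (GG1 : groupoid G1 X1) (GG2 : groupoid G2 X2) : Prop :=
  exists Phi, full_group_iso GG1 GG2 Phi.

Definition spatial (G1 X1 G2 X2 : topologicalType)
  (GG1 : groupoid G1 X1) (GG2 : groupoid G2 X2) (Phi : (X1 -> X1) -> (X2 -> X2)) : Prop :=
  exists (phi : X1 -> X2) (psi : X2 -> X1),
    [/\ cancel phi psi, cancel psi phi, continuous phi, continuous psi &
        forall gam, full_group GG1 gam -> Phi gam = phi \o gam \o psi].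

Definition standing (G X : topologicalType) (GG : groupoid G X) : Prop :=
  [/\ effective GG, ample GG, hausdorff_groupoid G, lc_cantor_space X &
    (forall x, exists a b c, [/\ orbit GG x a, orbit GG x b, orbit GG x c &
                                 [/\ a <> b, a <> c & b <> c]]) /\
    (forall A : set X, A !=set0 -> open A -> closed A ->
          exists x y z, [/\ A y, A z, y <> z, orbit GG x y & orbit GG x z])].

(* Main.v *)
(* The full group acts on the unit space with clopen compact supports (by
   effectiveness and Hausdorffness), contains a nontrivial involution supported
   in any given nonempty open set (two points of an orbit), and every compact
   open set is locally the intersection of two supports (three points of an
   orbit).  Rubin's algebraic disjointness then expresses inclusion of supports
   in the language of groups, so a group isomorphism preserves inclusion and
   disjointness of supports; a point is recovered from the supports containing
   it.  Conversely an effective groupoid is the groupoid of germs of its full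
   group, whose bisections cover it, so that a spatial isomorphism of the full
   groups induces an isomorphism of the groupoids. *)
Require Import Defs.
From mathcomp Require Import all_boot all_order all_algebra.
From mathcomp Require Import all_classical all_reals all_analysis.

Set Implicit Arguments.
Unset Strict Implicit.
Unset Printing Implicit Defensive.

Local Open Scope classical_set_scope.

(** * Group isomorphisms and algebraic disjointness *)

Definition group_iso (X1 X2 : Type) (A1 : set (X1 -> X1)) (A2 : set (X2 -> X2))
    (Phi : (X1 -> X1) -> (X2 -> X2)) : Prop :=
  [/\ forall a, A1 a -> A2 (Phi a),
      {in A1 &, injective Phi},
      forall b, A2 b -> exists2 a, A1 a & Phi a = b &
      forall a b, A1 a -> A1 b -> Phi (a \o b) = Phi a \o Phi b].

Record transformation_group (X : Type) (A : set (X -> X)) : Prop := {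
  tg_id : A id;
  tg_comp : forall f g, A f -> A g -> A (f \o g);
  tg_inv : forall f, A f -> exists f', [/\ A f', cancel f f' & cancel f' f] }.

Section Words.
Variables (X : Type) (A : set (X -> X)).

Definition commutator (f f' g g' : X -> X) : X -> X := f \o g \o f' \o g'.

(* Rubin's algebraic disjointness; the primed variables stand for inverses,
   and the inverse of [commutator f2 f2' h h'] is [commutator h h' f2 f2']. *)
Definition algebraically_disjoint (f g : X -> X) : Prop :=
  forall h h', A h -> A h' -> h \o h' = id -> f \o h <> h \o f ->
  exists f1 f1' f2 f2',
    [/\ [/\ A f1, A f1', A f2 & A f2'],
        f1 \o f1' = id /\ f2 \o f2' = id,
        f1 \o g = g \o f1 /\ f2 \o g = g \o f2 &
        let k := commutator f1 f1' (commutator f2 f2' h h')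
                                   (commutator h h' f2 f2') in
        k \o g = g \o k /\ k <> id].

(** A group-theoretic formula for inclusion of the support of [h] in that of [f]. The exponent
    appears because algebraic disjointness from [f] only forces the 12th power of [g] to fix the
    points that [f] moves. *)
Definition algebraic_subsupport (f h : X -> X) : Prop :=
  forall g, A g -> algebraically_disjoint f g ->
    h \o iter 12 g = iter 12 g \o h.

Hypothesis gA : transformation_group A.

Lemma tg_iter n g : A g -> A (iter n g).
Proof.
move=> Ag; elim: n => [|n IHn]; first exact: (tg_id gA).
exact: (tg_comp gA Ag IHn).
Qed.

Lemma tg_inverse f f' : A f -> f \o f' = id -> cancel f f' /\ cancel f' f.
Proof.
move=> /(tg_inv gA)[k [_ fK kK]] ff'.
have f'K : cancel f' f by move=> x; exact: (congr1 (@^~ x) ff').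
by split=> // x; apply: (can_inj fK); rewrite f'K.
Qed.

Lemma tg_commutator f f' g g' :
  A f -> A f' -> A g -> A g' -> A (commutator f f' g g').
Proof.
move=> Af Af' Ag Ag'.
exact: (tg_comp gA Af (tg_comp gA Ag (tg_comp gA Af' Ag'))).
Qed.

End Words.

(** * Transfer of group-theoretic formulas along an isomorphism *)

Section GroupIso.
Variables (X1 X2 : Type) (A1 : set (X1 -> X1)) (A2 : set (X2 -> X2)).
Hypotheses (gA1 : transformation_group A1) (gA2 : transformation_group A2).

Section Transfer.
Variable Phi : (X1 -> X1) -> (X2 -> X2).
Hypothesis isoPhi : group_iso A1 A2 Phi.

Lemma group_iso_in a : A1 a -> A2 (Phi a).
Proof. by case: isoPhi => + _ _ _; apply. Qed.

Lemma group_iso_inj a b : A1 a -> A1 b -> Phi a = Phi b -> a = b.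
Proof. by move=> Aa Ab; case: isoPhi => _ + _ _; apply; rewrite inE. Qed.

Lemma group_isoM a b : A1 a -> A1 b -> Phi (a \o b) = Phi a \o Phi b.
Proof. by case: isoPhi => _ _ _; apply. Qed.

Lemma group_iso_id : Phi id = id.
Proof.
have A1id := tg_id gA1.
have [k [_ PK _]] := tg_inv gA2 (group_iso_in A1id).
apply/funext => x; apply: (can_inj PK).
exact: (esym (congr1 (@^~ x) (group_isoM A1id A1id))).
Qed.

Lemma group_iso_iter n a : A1 a -> Phi (iter n a) = iter n (Phi a).
Proof.
move=> Aa; elim: n => [|n IHn]; first exact: group_iso_id.
have -> : iter n.+1 a = a \o iter n a by [].
by rewrite (group_isoM Aa (tg_iter gA1 n Aa)) IHn.
Qed.

Lemma group_iso_commutator f f' g g' : A1 f -> A1 f' -> A1 g -> A1 g' ->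
  Phi (commutator f f' g g') = commutator (Phi f) (Phi f') (Phi g) (Phi g').
Proof.
move=> Af Af' Ag Ag'; rewrite /commutator.
have A2' := tg_comp gA1 Af' Ag'; have A3 := tg_comp gA1 Ag A2'.
by rewrite (group_isoM Af A3) (group_isoM Ag A2') (group_isoM Af' Ag').
Qed.

Lemma group_iso_eq_id a b : A1 a -> A1 b -> Phi a \o Phi b = id -> a \o b = id.
Proof.
move=> Aa Ab E; apply: group_iso_inj; [exact: (tg_comp gA1)|exact: (tg_id gA1)|].
by rewrite group_isoM// group_iso_id.
Qed.

Lemma group_iso_comm a b : A1 a -> A1 b -> a \o b = b \o a ->
  Phi a \o Phi b = Phi b \o Phi a.
Proof. by move=> Aa Ab E; rewrite -!group_isoM// E. Qed.

(** The formula mentions only group elements, products and equalities: the universally quantified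
    pair is pulled back by surjectivity, and the witnesses are pushed forward. *)
Lemma algebraically_disjoint_transfer f g : A1 f -> A1 g ->
  algebraically_disjoint A1 f g -> algebraically_disjoint A2 (Phi f) (Phi g).
Proof.
case: (isoPhi) => _ _ surj _ Af Ag D h2 h2'.
move=> /surj[h Ah <-] /surj[h' Ah' <-] /(group_iso_eq_id Ah Ah') hh' nfh.
have {}nfh : f \o h <> h \o f by move=> E; apply: nfh; exact: group_iso_comm.
have [f1 [f1' [f2 [f2' [[A11 A11' A12 A12'] [e1 e2] [c1 c2]]]]]] :=
  D _ _ Ah Ah' hh' nfh.
set k := (k in let _ := k in _) => -[kg kid].
have Ak : A1 k by do 2?[apply: (tg_commutator gA1) => //].
exists (Phi f1), (Phi f1'), (Phi f2), (Phi f2'); split.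
- by split; exact: group_iso_in.
- by rewrite -!group_isoM// e1 e2 group_iso_id.
- by split; exact: group_iso_comm.
have -> : commutator (Phi f1) (Phi f1')
    (commutator (Phi f2) (Phi f2') (Phi h) (Phi h'))
    (commutator (Phi h) (Phi h') (Phi f2) (Phi f2')) = Phi k.
  by rewrite -!group_iso_commutator//; exact: (tg_commutator gA1).
split; first exact: group_iso_comm.
rewrite -group_iso_id => /group_iso_inj E; apply/kid/E => //.
exact: (tg_id gA1).
Qed.

End Transfer.

Lemma group_iso_inverse Phi : group_iso A1 A2 Phi ->
  exists Psi, [/\ group_iso A2 A1 Psi, forall a, A1 a -> Psi (Phi a) = a &
                  forall b, A2 b -> Phi (Psi b) = b].
Proof.
move=> iso; have [inPhi _ surj _] := iso.
(* Only the values on [A2] matter; elsewhere [id] serves as a default. *)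
have /choice[Psi PsiP] : forall b, exists a, A2 b -> A1 a /\ Phi a = b.
  move=> b; have [/surj[a ? ?]|nb] := pselect (A2 b); first by exists a.
  by exists id.
have inPsi b : A2 b -> A1 (Psi b) by move=> /PsiP[].
have PsiK b : A2 b -> Phi (Psi b) = b by move=> /PsiP[].
have PhiK a : A1 a -> Psi (Phi a) = a.
  by move=> Aa; apply: (group_iso_inj iso) => //; auto.
exists Psi; split => //; split => //.
- by move=> a b; rewrite !inE => Aa Ab /(congr1 Phi); rewrite !PsiK.
- by move=> a Aa; exists (Phi a); auto.
move=> a b Aa Ab; apply: (group_iso_inj iso).
- by apply: inPsi; exact: (tg_comp gA2).
- by apply: (tg_comp gA1); exact: inPsi.
- rewrite (group_isoM iso) ?PsiK//; [exact: (tg_comp gA2)|exact: inPsi|exact: inPsi].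
Qed.

End GroupIso.

(** Algebraic disjointness occurs as a premise here, so it has to be carried backwards, along the
    inverse isomorphism. *)
Lemma algebraic_subsupport_transfer (X1 X2 : Type) (A1 : set (X1 -> X1))
    (A2 : set (X2 -> X2)) Phi f h :
  transformation_group A1 -> transformation_group A2 -> group_iso A1 A2 Phi ->
  A1 f -> A1 h -> algebraic_subsupport A1 f h ->
  algebraic_subsupport A2 (Phi f) (Phi h).
Proof.
move=> gA1 gA2 iso Af Ah S g2 Ag2.
have [Psi [isoPsi PhiK PsiK]] := group_iso_inverse gA1 gA2 iso.
rewrite -(PsiK _ Ag2); set g := Psi g2.
have Ag : A1 g by exact: (group_iso_in isoPsi).
move=> /(algebraically_disjoint_transfer gA2 gA1 isoPsi
         (group_iso_in iso Af) (group_iso_in iso Ag)).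
rewrite !PhiK// => /(S _ Ag) E.
rewrite -(group_iso_iter gA1 gA2 iso)//.
by apply: (group_iso_comm iso) => //; exact: (tg_iter gA1).
Qed.

(** * Supports and locally moving groups *)

(* [support] alone is shadowed by MathComp's [0.-support]. *)
Local Notation supp := Defs.support.

Lemma open_local (X : topologicalType) (W : set X) :
  (forall x, W x -> exists V, [/\ open V, V x & V `<=` W]) -> open W.
Proof.
move=> loc; rewrite openE => x /loc[V [oV Vx VW]].
by apply: filterS VW _; exact: open_nbhs_nbhs.
Qed.

Lemma hausdorff_disjoint (X : topologicalType) (x y : X) :
  hausdorff_space X -> x <> y ->
  exists U V, [/\ open U, open V, U x, V y & forall z, U z -> ~ V z].
Proof.
rewrite open_hausdorff => hX /eqP /hX[[U V] /= [+ +] [oU oV /eqP UV]].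
rewrite !inE => Ux Vy; exists U, V; split => // z Uz Vz.
have : (U `&` V) z by [].
by rewrite UV.
Qed.

Section Displacement.
Variables (X : topologicalType).
Hypothesis hX : hausdorff_space X.

Lemma displace (f : X -> X) x : continuous f -> f x <> x ->
  exists W, [/\ open W, W x & forall y, W y -> ~ W (f y)].
Proof.
move=> /continuousP cf /nesym /(hausdorff_disjoint hX)[U [V [oU oV Ux Vfx UV]]].
exists (U `&` f @^-1` V); split => //.
  by apply: openI => //; exact: cf.
by move=> y [_ Vfy] [/UV].
Qed.

Lemma displaceW (f : X -> X) W x : continuous f -> f x <> x -> open W -> W x ->
  exists W', [/\ open W', W' x, W' `<=` W & forall y, W' y -> ~ W' (f y)].
Proof.
move=> cf /(displace cf)[V [oV Vx dV]] oW Wx; exists (V `&` W); split => //.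
  exact: openI.
by move=> y [/dV nV _] [/nV].
Qed.

Lemma displace_iter (f : X -> X) n x : continuous f ->
  (forall j, 0 < j <= n -> iter j f x <> x) ->
  exists W, [/\ open W, W x &
    forall j y, 0 < j <= n -> W y -> ~ W (iter j f y)].
Proof.
move=> cf; elim: n => [|n IHn] nfix.
  by exists setT; split => //; [exact: openT|case].
have [|W [oW Wx dW]] := IHn.
  by move=> j /andP[j0 jn]; apply: nfix; rewrite j0 ltnW.
have cfn : continuous (iter n.+1 f).
  elim: n.+1 => [|m IHm] y; first exact: cvg_id.
  exact: (continuous_comp (IHm y) (cf _)).
have [V [oV Vx VW dV]] := displaceW cfn (nfix n.+1 (ltnSn n)) oW Wx.
exists V; split => // j y /andP[j0]; rewrite leq_eqVlt => /predU1P[->|jn] Vy.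
  exact: dV.
by move=> /VW; apply: (dW j) => //; [rewrite j0|exact: VW].
Qed.

Lemma closed_support (f : X -> X) : closed (supp f).
Proof. exact: closed_closure. Qed.

Lemma in_support (f : X -> X) x : f x <> x -> supp f x.
Proof. by move=> /eqP fx; exact: subset_closure. Qed.

Lemma notin_support (f : X -> X) x : ~ supp f x -> f x = x.
Proof. by move=> nx; apply: contrapT => /in_support. Qed.

Lemma support_meets (f : X -> X) W x : supp f x -> open W -> W x ->
  exists2 y, W y & f y <> y.
Proof.
move=> sx oW Wx; have [y [/= /eqP fy Wy]] := sx _ (open_nbhs_nbhs (conj oW Wx)).
by exists y.
Qed.

Lemma support_sub (f : X -> X) C : closed C -> (forall x, f x <> x -> C x) ->
  supp f `<=` C.
Proof.
move=> cC fC; rewrite /supp closureE; apply: smallest_sub => // x /= /eqP.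
exact: fC.
Qed.

Lemma moved_id (f : X -> X) : f <> id -> exists x, f x <> x.
Proof.
move=> fid; apply: contrapT => nex; apply: fid; apply/funext => x.
by apply: contrapT => fx; apply: nex; exists x.
Qed.

End Displacement.

(** An injective map sends moved points to moved points, so if [g] moves [x] then [f] fixes both [x]
    and [g x], and symmetrically. *)
Lemma alternative_fix_comm (X : Type) (f g : X -> X) :
  injective f -> injective g -> (forall x, f x = x \/ g x = x) ->
  f \o g = g \o f.
Proof.
move=> fI gI fg; apply/funext => x /=.
have [fx|gx] := fg x.
  rewrite fx; have [//|/gI gx] := fg (g x).
  by rewrite gx fx.
rewrite gx; have [/fI fx|//] := fg (f x).
by rewrite fx gx.
Qed.

(** A form of Rubin's locally moving groups. [lm_basis] asks for two supports rather than one
    because an element moving [x] may have to carry it out of [W]. *)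
Record locally_moving (X : topologicalType) (A : set (X -> X)) : Prop := {
  lm_group : transformation_group A;
  lm_hausdorff : hausdorff_space X;
  lm_cont : forall f, A f -> continuous f;
  lm_support_open : forall f, A f -> open (supp f);
  lm_support_compact : forall f, A f -> compact (supp f);
  lm_involution : forall W, open W -> W !=set0 ->
    exists t, [/\ A t, involutive t, t <> id & forall x, t x <> x -> W x];
  lm_basis : forall x W, open W -> W x ->
    exists f g, [/\ A f, A g, supp f x, supp g x &
                    supp f `&` supp g `<=` W] }.

Section LocallyMoving.
Variables (X : topologicalType) (A : set (X -> X)).
Hypothesis lmA : locally_moving A.

Let gA := lm_group lmA.
Let hX := lm_hausdorff lmA.

Lemma lm_inj f : A f -> injective f.
Proof. by move=> /(tg_inv gA)[k [_ fK _]]; exact: can_inj fK. Qed.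

Lemma lm_inverse f : A f -> exists f', [/\ A f', f \o f' = id & f' \o f = id].
Proof.
move=> /(tg_inv gA)[f' [Af' fK f'K]].
by exists f'; split => //; apply/funext.
Qed.

(** As the support of [h] is open, it contains a point moved by [f]; moved points of [h] are dense
    in that support, so one lies close enough to be moved by [f] as well. *)
Lemma common_moved f h x : A f -> A h -> supp f x -> supp h x ->
  exists y, f y <> y /\ h y <> y.
Proof.
move=> Af Ah fx hx.
have [y hy fy] := support_meets fx (lm_support_open lmA Ah) hx.
have [W [oW Wy dW]] := displace hX (lm_cont lmA Af) fy.
have [z Wz hz] := support_meets hy oW Wy.
by exists z; split => // E; apply: (dW z) => //; rewrite E.
Qed.

Lemma stays_in (f : X -> X) (W : set X) x : injective f ->
  (forall y, f y <> y -> W y) -> W x -> W (f x).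
Proof.
move=> fI fW Wx; apply: contrapT => nW; apply: (nW).
suff /fI -> : f (f x) = f x by [].
by apply: contrapT => /fW.
Qed.

(** Take [t] moving [B] off itself and [s] supported in [B]. At a point [y] moved by [s], the map
    [s] fixes [t y], so the two products differ. *)
Lemma noncommuting_in W : open W -> W !=set0 ->
  exists f g, [/\ A f, A g, forall x, f x <> x -> W x,
                  forall x, g x <> x -> W x & f \o g <> g \o f].
Proof.
move=> oW W0; have [t [At _ /moved_id[x tx] tW]] := lm_involution lmA oW W0.
have [B [oB Bx BW dB]] := displaceW hX (lm_cont lmA At) tx oW (tW _ tx).
have [|s [As _ /moved_id[y sy] sB]] := lm_involution lmA oB; first by exists x.
exists t, s; split => //; first by move=> z /sB /BW.
have By := sB _ sy; move=> /(congr1 (@^~ y)) /= E.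
apply: sy; apply: (lm_inj At); rewrite E.
by apply: contrapT => /sB; exact: dB.
Qed.

(* If t is an involution moving B off itself and s is supported in B, then
   the square of t \o s restricts to s on B. *)
Lemma moved_by_double_power n :
  (forall W, open W -> W !=set0 -> exists g x,
     [/\ A g, forall y, g y <> y -> W y & iter n g x <> x]) ->
  forall W, open W -> W !=set0 -> exists g x,
     [/\ A g, forall y, g y <> y -> W y & iter n.*2 g x <> x].
Proof.
move=> Pn W oW W0; have [t [At tt /moved_id[x tx] tW]] := lm_involution lmA oW W0.
have [B [oB Bx BW dB]] := displaceW hX (lm_cont lmA At) tx oW (tW _ tx).
have [|s [y [As sB sy]]] := Pn B oB; first by exists x.
have By : B y.
  apply: contrapT => nBy; apply: sy.
  have sy : s y = y by apply: contrapT => /sB.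
  by elim: n {Pn} => //= m ->.
exists (t \o s), y; split.
- exact: (tg_comp gA).
- move=> z ts; have [sz|/sB/BW//] := pselect (s z = z).
  by apply: tW => tz; apply: ts; rewrite /= sz.
have sBB z : B z -> B (s z) by exact: stays_in (lm_inj As) sB.
suff H m z : B z -> iter m.*2 (t \o s) z = iter m s z by rewrite H.
elim: m z => // m IHm z Bz; rewrite doubleS !iterSr.
have -> : (t \o s) ((t \o s) z) = s z.
  rewrite /=; have -> : s (t (s z)) = t (s z).
    by apply: contrapT => /sB; apply: dB; exact: sBB.
  exact: tt.
by rewrite IHm//; exact: sBB.
Qed.

(** An involution equals its own cube, which settles exponent 3; two doublings give 12. *)
Lemma moved_by_iter12 W : open W -> W !=set0 ->
  exists g x, [/\ A g, forall y, g y <> y -> W y & iter 12 g x <> x].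
Proof.
have -> : 12 = 3.*2.*2 by [].
apply: moved_by_double_power; apply: moved_by_double_power => V oV V0.
have [t [At tt /moved_id[x tx] tV]] := lm_involution lmA oV V0.
by exists t, x; split => //=; rewrite tt.
Qed.

(** Around a point moved by both [f] and [h] there is an open [W] that both move off itself, and
    there [g] is the identity. Noncommuting [f1], [f2] supported in [W] are the witnesses: their
    double commutator with [h] collapses to the commutator of [f1] and [f2]. *)
Lemma algebraically_disjoint_of_disjoint f g : A f -> A g ->
  (forall x, f x = x \/ g x = x) -> algebraically_disjoint A f g.
Proof.
move=> Af Ag fg h h' Ah Ah' hh' nfh.
have [hK h'K] := tg_inverse gA Ah hh'.
have [x [fx hx]] : exists x, f x <> x /\ h x <> x.
  apply: contrapT => nex; apply: nfh.
  apply: (alternative_fix_comm (lm_inj Af) (lm_inj Ah)) => x.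
  have [|fx] := pselect (f x = x); first by left.
  by right; apply: contrapT => hx; apply: nex; exists x.
have [V [oV Vx dV]] := displace hX (lm_cont lmA Af) fx.
have [W [oW Wx WV dW]] := displaceW hX (lm_cont lmA Ah) hx oV Vx.
have gW y : W y -> g y = y.
  move=> Wy; have [fy|//] := fg y.
  by case: (dV y (WV _ Wy)); rewrite fy; exact: WV.
have [|f1 [f2 [A1 A2 W1 W2 n12]]] := noncommuting_in oW; first by exists x.
have [f1' [A1' e1 e1']] := lm_inverse A1.
have [f2' [A2' e2 e2']] := lm_inverse A2.
have [f1K f1'K] := tg_inverse gA A1 e1.
have [f2K f2'K] := tg_inverse gA A2 e2.
have inW k k' : (forall y, k y <> y -> W y) -> cancel k k' -> cancel k' k ->
    forall y, k' y <> y -> W y.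
  by move=> kW kK k'K y k'y; apply: kW => ky; apply: k'y; rewrite -{1}ky kK.
have W1' := inW _ _ W1 f1K f1'K; have W2' := inW _ _ W2 f2K f2'K.
have gC k : A k -> (forall y, k y <> y -> W y) -> k \o g = g \o k.
  move=> Ak kW; apply: (alternative_fix_comm (lm_inj Ak) (lm_inj Ag)) => y.
  have [|/kW/gW] := pselect (k y = y); first by left.
  by right.
exists f1, f1', f2, f2'; split => //.
  by split; apply: gC.
(* This conjugate is supported in the translate of [W] by [h], which is disjoint from [W]. It
   therefore commutes with [f1'] and cancels from the double commutator. *)
have Aq : A (h \o f2' \o h') := tg_comp gA (tg_comp gA Ah A2') Ah'.
have qC : f1' \o (h \o f2' \o h') = (h \o f2' \o h') \o f1'.
  apply: (alternative_fix_comm (lm_inj A1') (lm_inj Aq)) => y.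
  have [|/W1' Wy] := pselect (f1' y = y); first by left.
  right; rewrite /=; suff -> : f2' (h' y) = h' y by rewrite h'K.
  by apply: contrapT => /W2' /dW; rewrite h'K.
rewrite [commutator f1 _ _ _](_ : _ = commutator f1 f1' f2 f2'); last first.
  apply/funext => y; rewrite /commutator /=.
  set z := f2' y; have /= <- := congr1 (@^~ (h (f2 (h' z)))) qC.
  by rewrite hK f2K h'K.
split; last first.
  move=> E; apply: n12; apply/funext => y.
  by have := congr1 (@^~ (f2 (f1 y))) E; rewrite /commutator /= f2K f1K.
have C1 := gC _ A1 W1; have C2 := gC _ A2 W2.
have C1' := gC _ A1' W1'; have C2' := gC _ A2' W2'.
apply/funext => y; rewrite /commutator /=.
have /= -> := congr1 (@^~ y) C2'; have /= -> := congr1 (@^~ (f2' y)) C1'.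
have /= -> := congr1 (@^~ (f1' (f2' y))) C2.
by have /= -> := congr1 (@^~ (f2 (f1' (f2' y)))) C1.
Qed.

(* The double commutator is supported in four translates of W by elements
   commuting with g, so by pigeonhole two of the points p, g p, ..., g^4 p
   lie in the same translate.  As 12 = lcm(1,2,3,4), a point moved by g^12 is
   moved by g, ..., g^4, so W may be chosen disjoint from its translates by
   these. *)
Lemma fixed_of_algebraically_disjoint f g : A f -> A g ->
  algebraically_disjoint A f g -> forall x, f x = x \/ iter 12 g x = x.
Proof.
move=> Af Ag D x; have [|fx] := pselect (f x = x); first by left.
right; apply: contrapT => gx.
have gj j : 0 < j <= 4 -> iter j g x <> x.
  move=> j4 E; apply: gx.
  have iterM m : iter (m * j) g x = x.
    by elim: m => // m IHm; rewrite mulSn iterD IHm.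
  have -> : 12 = 12 %/ j * j by case: j j4 {E iterM} => [|[|[|[|[|]]]]].
  exact: iterM.
have [V [oV Vx dV]] := displace_iter hX (lm_cont lmA Ag) gj.
have [W [oW Wx WV dW]] := displaceW hX (lm_cont lmA Af) fx oV Vx.
(* An involution is its own inverse, so [h] fills both places of the pair in [D]; it does not
   commute with [f], which moves [W] off itself. *)
have [|h [Ah hh /moved_id[y hy] hW]] := lm_involution lmA oW; first by exists x.
have [||f1 [f1' [f2 [f2' [[A1 A1' A2 A2'] [e1 e2] [c1 c2]]]]]] := D h h Ah Ah.
- exact/funext.
- move=> /(congr1 (@^~ y)) /= E; have Wy := hW _ hy.
  apply: hy; apply: (lm_inj Af); rewrite E.
  by apply: contrapT => /hW; exact: dW.
set u := commutator f2 _ _ _; set u' := commutator h _ _ _.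
move=> [kg /moved_id[p kp]].
have [f1K f1'K] := tg_inverse gA A1 e1.
have [f2K f2'K] := tg_inverse gA A2 e2.
have inv_comm k k' : cancel k k' -> cancel k' k -> k \o g = g \o k ->
    forall z, k' (g z) = g (k' z).
  move=> kK k'K kC z; rewrite -{1}(k'K z).
  by have /= <- := congr1 (@^~ (k' z)) kC; rewrite kK.
have c1' := inv_comm _ _ f1K f1'K c1; have c2' := inv_comm _ _ f2K f2'K c2.
have uW z : ~ W z -> ~ W (f2' z) -> u z = z /\ u' z = z.
  have hfix w : ~ W w -> h w = w by move=> nW; apply: contrapT => /hW.
  move=> Wz W2z; rewrite /u /u' /commutator /=.
  by rewrite !(hfix _ Wz) !(hfix _ W2z) f2'K !(hfix _ Wz).
(* The preimages of [W] under these four maps are the translates of [W] by [id], [f2], [f1] and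
   [f1 \o f2]. Outside all of them the double commutator is the identity. *)
pose c (i : 'I_4) : X -> X := match val i with
  | 0 => id | 1 => f2' | 2 => f1' | _ => f2' \o f1' end.
have cg i z : c i (g z) = g (c i z).
  by case: i => [[|[|[|[|]]]]] //= ?; rewrite /c //= c1' c2'.
have cgn i n z : c i (iter n g z) = iter n g (c i z).
  by elim: n => //= n IHn; rewrite cg IHn.
have covered z : commutator f1 f1' u u' z <> z -> exists i, W (c i z).
  move=> kz; apply: contrapT => nW; apply: kz.
  have nWi (i : 'I_4) : ~ W (c i z) by move=> Wi; apply: nW; exists i.
  rewrite /commutator /=.
  have [_ ->] := uW z (nWi ord0) (nWi (@Ordinal 4 1 isT)).
  have [-> _] := uW (f1' z) (nWi (@Ordinal 4 2 isT)) (nWi (@Ordinal 4 3 isT)).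
  by rewrite f1'K.
(* The double commutator commutes with [g], so it moves the whole forward [g]-orbit of [p]. *)
have kgn n : commutator f1 f1' u u' (iter n g p) <> iter n g p.
  elim: n => // n IHn; rewrite iterS.
  have /= -> := congr1 (@^~ (iter n g p)) kg.
  by move=> /(lm_inj Ag).
have /choice[F FW] : forall n : 'I_5, exists i, W (c i (iter n g p)).
  by move=> n; exact: covered (kgn n).
have : ~ injective F by move=> /fintype.leq_card; rewrite !card_ord.
apply=> i j; wlog ij : i j / i <= j => [H|] Fij.
  by have [ij|/ltnW ji] := leqP i j; [exact: H|apply/esym/H].
apply: contrapT => nij; apply: (dV (j - i) (c (F i) (iter i g p))).
- rewrite subn_gt0 ltn_neqAle ij andbT; apply/andP; split.
    by apply/eqP => /val_inj.
  by rewrite (leq_trans (leq_subr _ _))// -ltnS.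
- exact/WV/FW.
rewrite -cgn -iterD subnK// Fij; exact/WV/FW.
Qed.

(** If the supports are not included, some [g] living off the support of [f], inside a set displaced
    by [h], has a 12th power not commuting with [h]. If they are, a point moved by [h] and by the
    12th power of [g] would yield one moved by [f] and by that power, which algebraic disjointness
    forbids. *)
Lemma algebraic_subsupportP f h : A f -> A h ->
  algebraic_subsupport A f h <-> supp h `<=` supp f.
Proof.
move=> Af Ah; split=> [S x hx|hf g Ag /(fixed_of_algebraically_disjoint Af Ag) fg].
  apply: contrapT => nfx.
  have oV : open (~` supp f) by exact/closed_openC/closed_support.
  have [y Vy hy] := support_meets hx oV nfx.
  have [W [oW Wy WV dW]] := displaceW hX (lm_cont lmA Ah) hy oV Vy.
  have [|g [z [Ag gW gz]]] := moved_by_iter12 oW; first by exists y.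
  have Wz : W z.
    apply: contrapT => nW; apply: gz; have gz : g z = z by apply: contrapT => /gW.
    by elim: 12 => //= n ->.
  have : h \o iter 12 g = iter 12 g \o h.
    apply: S => //; apply: algebraically_disjoint_of_disjoint => // w.
    have [|gw] := pselect (g w = w); first by right.
    by left; apply: notin_support; apply: WV; exact: gW.
  move=> /(congr1 (@^~ z)); rewrite [RHS]/comp.
  have ghz : g (h z) = h z by apply: contrapT => /gW; exact: dW.
  have -> : iter 12 g (h z) = h z by elim: 12 => //= n ->.
  by move=> /(lm_inj Ah).
apply: (alternative_fix_comm (lm_inj Ah) (lm_inj (tg_iter gA 12 Ag))) => x.
 have [|hx] := pselect (h x = x); first by left.
right; apply: contrapT => gx.
have [y [fy]] :=
  common_moved Af (tg_iter gA 12 Ag) (hf _ (in_support hx)) (in_support gx).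
by apply; case: (fg y).
Qed.

Lemma support_separates y y' :
  (forall f, A f -> supp f y <-> supp f y') -> y = y'.
Proof.
move=> yy'; apply: contrapT => /(hausdorff_disjoint hX)[U [V [oU oV Uy Vy' UV]]].
have [f [g [Af Ag fy gy fgU]]] := lm_basis lmA oU Uy.
apply: UV Vy'; apply: fgU; split; exact/yy'.
Qed.

Lemma open_generated_by_support W :
  (forall x, W x -> exists f g, [/\ A f, A g, supp f x, supp g x &
                    supp f `&` supp g `<=` W]) -> open W.
Proof.
move=> H; apply: open_local => x /H[f [g [Af Ag fx gx fgW]]].
exists (supp f `&` supp g); split => //.
by apply: openI; exact: (lm_support_open lmA).
Qed.

End LocallyMoving.

Lemma support_sub_transfer (X1 X2 : topologicalType)
    (A1 : set (X1 -> X1)) (A2 : set (X2 -> X2)) Phi f h :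
  locally_moving A1 -> locally_moving A2 -> group_iso A1 A2 Phi ->
  A1 f -> A1 h -> supp h `<=` supp f -> supp (Phi h) `<=` supp (Phi f).
Proof.
move=> lm1 lm2 iso Af Ah /(algebraic_subsupportP lm1 Af Ah) S.
apply/(algebraic_subsupportP lm2 (group_iso_in iso Af) (group_iso_in iso Ah)).
exact: algebraic_subsupport_transfer (lm_group lm1) (lm_group lm2) iso Af Ah S.
Qed.

(** * Recovering the points *)

Section PointMap.
Variables (X1 X2 : topologicalType).
Variables (A1 : set (X1 -> X1)) (A2 : set (X2 -> X2)).
Hypotheses (lm1 : locally_moving A1) (lm2 : locally_moving A2).

Let gA1 := lm_group lm1.
Let gA2 := lm_group lm2.

(** Were the image supports to meet, a nontrivial [t] supported in their open intersection would
    pull back to a nontrivial element supported in both original supports. *)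
Lemma support_disjoint_transfer Phi f h : group_iso A1 A2 Phi -> A1 f -> A1 h ->
  (forall x, supp f x -> ~ supp h x) -> forall y, supp (Phi f) y -> ~ supp (Phi h) y.
Proof.
move=> iso Af Ah fh y fy hy.
have [Psi [isoPsi PhiK PsiK]] := group_iso_inverse gA1 gA2 iso.
have A2f := group_iso_in iso Af; have A2h := group_iso_in iso Ah.
have oW := openI (lm_support_open lm2 A2f) (lm_support_open lm2 A2h).
have [|t [At _ tid tW]] := lm_involution lm2 oW; first by exists y.
have tW' : supp t `<=` supp (Phi f) `&` supp (Phi h).
  by apply: support_sub => //; apply: closedI; exact: closed_support.
have Psit := group_iso_in isoPsi At.
have /moved_id[x /in_support tx] : Psi t <> id.
  by move=> E; apply: tid; rewrite -(PsiK t At) E (group_iso_id gA1 gA2 iso).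
apply: (fh x).
  move: x tx; rewrite -(PhiK f Af).
  by apply: (support_sub_transfer lm2 lm1 isoPsi A2f At) => z /tW'[].
move: x tx; rewrite -(PhiK h Ah).
by apply: (support_sub_transfer lm2 lm1 isoPsi A2h At) => z /tW'[].
Qed.

(* The sets [supp (Phi k)], for k supported near x, converge to the image of x. *)
Lemma point_image Phi x : group_iso A1 A2 Phi ->
  exists y, forall f, A1 f -> supp f x <-> supp (Phi f) y.
Proof.
move=> iso.
pose F : set_system X2 := [set S | exists W, [/\ open W, W x &
  forall k, A1 k -> k <> id -> supp k `<=` W -> supp (Phi k) `<=` S]].
have FF : ProperFilter F.
  apply: Build_ProperFilter => [[W [oW Wx WS]]|].
    have [f [g [Af Ag fx gx fgW]]] := lm_basis lm1 oW Wx.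
    have oV := openI (lm_support_open lm1 Af) (lm_support_open lm1 Ag).
    have [|t [At _ tid tV]] := lm_involution lm1 oV; first by exists x.
    have tW : supp t `<=` W.
      apply: subset_trans fgW; apply: support_sub => //.
      by apply: closedI; exact: closed_support.
    have /moved_id[y /in_support] : Phi t <> id.
      move=> E; apply: tid; apply: (group_iso_inj iso) => //; first exact: (tg_id gA1).
      by rewrite E (group_iso_id gA1 gA2 iso).
    exact: WS.
  split.
  - by exists setT; split => //; exact: openT.
  - move=> S T [W [oW Wx WS]] [V [oV Vx VT]]; exists (W `&` V); split => //.
      exact: openI.
    move=> k Ak kid kWV y ky; split.
      by apply: (WS k) => // z /kWV[].
    by apply: (VT k) => // z /kWV[].
  - move=> S T ST [W [oW Wx WS]]; exists W; split => // k Ak kid kW.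
    exact: subset_trans (WS k Ak kid kW) ST.
have F1 f : A1 f -> supp f x -> F (supp (Phi f)).
  move=> Af fx; exists (supp f); split => //; first exact: (lm_support_open lm1).
  by move=> k Ak _; exact: (support_sub_transfer lm1 lm2 iso Af Ak).
have [f0 [_ [A0 _ f0x _ _]]] := lm_basis lm1 (@openT X1) (I : setT x).
(* One support around [x] puts a compact set into the filter, which therefore has a cluster
   point. *)
have [y [_ clFy]] := lm_support_compact lm2 (group_iso_in iso A0) FF (F1 _ A0 f0x).
exists y => f Af; split=> [fx|fy].
  apply: closed_support => B By; exact: (clFy _ _ (F1 _ Af fx) By).
(* If [x] is off the support of [f], elements supported near [x] have images disjoint from the
   support of [Phi f]. The complement of that support then lies in the filter, while the support
   itself is a neighbourhood of the cluster point. *)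
apply: contrapT => nfx.
have oPhif := lm_support_open lm2 (group_iso_in iso Af).
have nPhif := open_nbhs_nbhs (conj oPhif fy).
have [|z []//] := clFy (~` supp (Phi f)) (supp (Phi f)) _ nPhif.
exists (~` supp f); split => //; first exact/closed_openC/closed_support.
move=> k Ak _ kf z kz; apply: (support_disjoint_transfer iso Ak Af _ kz).
by move=> w /kf.
Qed.

End PointMap.

Lemma support_conj (X : topologicalType) (A : set (X -> X)) f g g' x :
  locally_moving A -> A g -> A g' -> cancel g g' -> cancel g' g ->
  supp (g \o f \o g') (g x) <-> supp f x.
Proof.
move=> lmA Ag Ag' gK g'K.
have cg := lm_cont lmA Ag; have cg' := lm_cont lmA Ag'.
split=> sx B Bx.
  have [|y [/= /eqP my By]] := sx (g' @^-1` B).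
    by apply: cg'; rewrite gK.
  exists (g' y); split => //=; apply/eqP => E; apply: my.
  by rewrite E g'K.
have [|y [/= /eqP my By]] := sx (g @^-1` B); first exact: cg.
exists (g y); split => //=; apply/eqP; rewrite gK => E; apply: my.
exact: (can_inj gK).
Qed.

(** Points are determined by the supports containing them, so the point maps of [Phi] and of its
    inverse are mutually inverse. Each pulls supports back to supports, and intersections of two
    supports form a basis, whence continuity. *)
Lemma locally_moving_spatial (X1 X2 : topologicalType)
    (A1 : set (X1 -> X1)) (A2 : set (X2 -> X2)) Phi :
  locally_moving A1 -> locally_moving A2 -> group_iso A1 A2 Phi ->
  exists (phi : X1 -> X2) (psi : X2 -> X1),
    [/\ cancel phi psi, cancel psi phi, continuous phi, continuous psi &
        forall a, A1 a -> Phi a = phi \o a \o psi].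
Proof.
move=> lm1 lm2 iso; have gA1 := lm_group lm1; have gA2 := lm_group lm2.
have [Psi [isoPsi PhiK PsiK]] := group_iso_inverse gA1 gA2 iso.
have /choice[phi phiP] := fun x => point_image lm1 lm2 x iso.
have /choice[psi psiP] := fun x => point_image lm2 lm1 x isoPsi.
have phiK : cancel phi psi.
  move=> x; apply: (support_separates lm1) => f Af.
  have Aphif := group_iso_in iso Af.
  apply: iff_sym; apply: (iff_trans (phiP x f Af)).
  by apply: (iff_trans (psiP _ _ Aphif)); rewrite PhiK.
have psiK : cancel psi phi.
  move=> x; apply: (support_separates lm2) => f Af.
  have Apsif := group_iso_in isoPsi Af.
  apply: iff_sym; apply: (iff_trans (psiP x f Af)).
  by apply: (iff_trans (phiP _ _ Apsif)); rewrite PsiK.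
exists phi, psi; split => //.
- apply/continuousP => W oW; apply: (open_generated_by_support lm1) => x Wx.
  have [f [g [Af Ag fx gx fgW]]] := lm_basis lm2 oW Wx.
  have Apsif := group_iso_in isoPsi Af; have Apsig := group_iso_in isoPsi Ag.
  exists (Psi f), (Psi g); split => //.
  + by apply/phiP => //; rewrite PsiK.
  + by apply/phiP => //; rewrite PsiK.
  + move=> y [/phiP fy /phiP gy]; apply: fgW.
    by rewrite -(PsiK f)// -(PsiK g)//; split; auto.
- apply/continuousP => W oW; apply: (open_generated_by_support lm2) => x Wx.
  have [f [g [Af Ag fx gx fgW]]] := lm_basis lm1 oW Wx.
  have Aphif := group_iso_in iso Af; have Aphig := group_iso_in iso Ag.
  exists (Phi f), (Phi g); split => //.
  + by apply/psiP => //; rewrite PhiK.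
  + by apply/psiP => //; rewrite PhiK.
  + move=> y [/psiP fy /psiP gy]; apply: fgW.
    by rewrite -(PhiK f)// -(PhiK g)//; split; auto.
move=> a Aa; suff H x : phi (a x) = Phi a (phi x).
  by apply/funext => y /=; rewrite H psiK.
have [a' [Aa' aK a'K]] := tg_inv gA1 Aa.
have Ab := group_iso_in iso Aa; have Ab' := group_iso_in iso Aa'.
have bb' : Phi a \o Phi a' = id.
  rewrite -(group_isoM iso)// -(group_iso_id gA1 gA2 iso); congr Phi.
  exact/funext.
have [bK b'K] := tg_inverse gA2 Ab bb'.
(* Equivariance: both points lie in the same supports, since conjugating by [a] translates a support
   by [a], and likewise for [Phi a]. *)
apply: (support_separates lm2) => g Ag.
rewrite -(PsiK g Ag); set f := Psi g; have Af : A1 f by exact: (group_iso_in isoPsi).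
apply: (iff_trans (iff_sym (phiP _ _ Af))).
have Ah : A1 (a' \o f \o a) := tg_comp gA1 (tg_comp gA1 Aa' Af) Aa.
have {2}-> : f = a \o (a' \o f \o a) \o a'.
  by apply/funext => y /=; rewrite !a'K.
have -> : Phi (a \o (a' \o f \o a) \o a') = Phi a \o Phi (a' \o f \o a) \o Phi a'.
  by rewrite (group_isoM iso (tg_comp gA1 Aa Ah) Aa') (group_isoM iso Aa Ah).
apply: iff_sym; apply: (iff_trans (support_conj _ _ lm2 Ab Ab' bK b'K)).
apply: (iff_trans (iff_sym (phiP _ _ Ah))).
apply: (iff_trans (iff_sym (support_conj _ _ lm1 Aa Aa' aK a'K))).
suff -> : a \o (a' \o f \o a) \o a' = f by [].
by apply/funext => y /=; rewrite !a'K.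
Qed.

(** * Bisections and the full group *)

Lemma open_preimage (B C : topologicalType) (f : B -> C) W :
  continuous f -> open W -> open (f @^-1` W).
Proof. by move=> /continuousP; exact. Qed.

Lemma local_homeo_open (B C : topologicalType) (f : B -> C) W :
  local_homeo f -> open W -> open (f @` W).
Proof.
move=> [_ lf] oW; apply: open_local => _ [a Wa <-].
have [U [oU Ua _ fU]] := lf a.
exists (f @` (U `&` W)); split.
- by apply: fU => [|z []//]; exact: openI.
- by exists a.
- by move=> _ [z [_ Wz] <-]; exists z.
Qed.

Section Bisections.
Variables (G X : topologicalType) (GG : groupoid G X).
Local Notation s := (gs GG).
Local Notation r := (gr GG).
Local Notation unit := (gunit GG).
Local Notation inv := (ginv GG).
Local Notation mul := (gmul GG).

Lemma ginvK : involutive inv.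
Proof.
move=> g; rewrite -[LHS](gmul_unitr GG) gs_inv gr_inv -gmulVl -gmulA.
- by rewrite gmulVl gs_inv gmul_unitl.
- by rewrite gs_inv.
- by rewrite gs_inv.
Qed.

Lemma ginv_unit x : inv (unit x) = unit x.
Proof. by rewrite -[LHS](gmul_unitr GG) gs_inv gr_unit gmulVl gs_unit. Qed.

Lemma gmulKV g h : s g = r h -> mul (inv g) (mul g h) = h.
Proof.
move=> gh; rewrite -gmulA//; last by rewrite gs_inv.
by rewrite gmulVl gh gmul_unitl.
Qed.

Lemma gmulK g h : r g = r h -> mul g (mul (inv g) h) = h.
Proof.
by move=> gh; rewrite -{1}(ginvK g) gmulKV// gs_inv.
Qed.

Lemma gmulVK g h : s g = s h -> mul (mul g (inv h)) h = g.
Proof.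
move=> gh; rewrite gmulA ?gr_inv ?gs_inv//.
by rewrite gmulVl -gh gmul_unitr.
Qed.

Lemma range_unitP g : range unit g <-> unit (s g) = g.
Proof.
by split=> [[x _ <-]|<-]; [rewrite gs_unit|exists (s g)].
Qed.

Definition bisection_mul (U V : set G) : set G :=
  [set k | exists g h, [/\ U g, V h, s g = r h & k = mul g h]].

Lemma bisection_injs U g h : bisection GG U -> U g -> U h -> s g = s h -> g = h.
Proof. by move=> [_ [inj _]] Ug Uh; apply: inj; rewrite inE. Qed.

Lemma bisection_injr U g h : bisection GG U -> U g -> U h -> r g = r h -> g = h.
Proof. by move=> [_ [_ inj]] Ug Uh; apply: inj; rewrite inE. Qed.

Lemma full_bisections U x : full_bisection GG U -> exists2 u, U u & s u = x.
Proof. by move=> [_ [sU _]]; have : [set: X] x by []; rewrite -sU. Qed.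

Lemma full_bisectionr U x : full_bisection GG U -> exists2 u, U u & r u = x.
Proof. by move=> [_ [_ rU]]; have : [set: X] x by []; rewrite -rU. Qed.

Lemma full_bisectionP U :
  open U -> (forall g h, U g -> U h -> s g = s h -> g = h) ->
  (forall g h, U g -> U h -> r g = r h -> g = h) ->
  (forall x, exists2 u, U u & s u = x) -> (forall x, exists2 u, U u & r u = x) ->
  full_bisection GG U.
Proof.
move=> oU sI rI sT rT; split; last split.
- by split => //; split => g h; rewrite !inE; [exact: sI|exact: rI].
- by apply/seteqP; split => // x _; exact: sT.
- by apply/seteqP; split => // x _; exact: rT.
Qed.

Lemma full_bisection_pi U : full_bisection GG U -> exists f, is_pi GG U f.
Proof.
move=> fU; have /choice[u uP] : forall x, exists u, U u /\ s u = x.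
  by move=> x; have [u] := full_bisections x fU; exists u.
exists (r \o u) => g Ug /=; congr r.
by apply: (bisection_injs fU.1) => //; have [] := uP (s g).
Qed.

Lemma full_bisection_inv U f f' : full_bisection GG U -> is_pi GG U f ->
  cancel f f' -> full_bisection GG (inv @^-1` U) /\ is_pi GG (inv @^-1` U) f'.
Proof.
move=> fU pU fK; have bU := fU.1; have [oU _] := bU; split; last first.
  by move=> g /pU; rewrite gs_inv gr_inv => <-; rewrite fK.
apply: full_bisectionP.
- exact: open_preimage (@ginv_cont _ _ GG) _.
- move=> g h Ug Uh gh; apply: (can_inj ginvK); apply: (bisection_injr bU) => //.
  by rewrite !gr_inv.
- move=> g h Ug Uh gh; apply: (can_inj ginvK); apply: (bisection_injs bU) => //.
  by rewrite !gs_inv.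
- move=> x; have [u Uu <-] := full_bisectionr x fU.
  by exists (inv u); rewrite ?gs_inv//= ginvK.
- move=> x; have [u Uu <-] := full_bisections x fU.
  by exists (inv u); rewrite ?gr_inv//= ginvK.
Qed.

Hypothesis stG : standing GG.

Let effG : effective GG. Proof. by case: stG. Qed.
Let hG : hausdorff_space G. Proof. by case: stG. Qed.
Let hX : hausdorff_space X. Proof. by case: stG => _ [_ []]. Qed.
Let cobX : compact_open_basis X. Proof. by case: stG => _ [_ []]. Qed.
Let lhr : local_homeo r. Proof. by case: stG => _ [[]]. Qed.
Let lhs : local_homeo s. Proof. by case: stG => _ [[]]. Qed.

Let preim_s W : open W -> open (s @^-1` W).
Proof. exact: open_preimage (@gs_cont _ _ GG). Qed.

Let preim_r W : open W -> open (r @^-1` W).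
Proof. exact: open_preimage (@gr_cont _ _ GG). Qed.

Lemma open_units : open (range unit).
Proof. by rewrite -effG; exact: open_interior. Qed.

(** The units are the fixed points of the continuous map [unit \o s] on a Hausdorff space. *)
Lemma closed_units : closed (range unit).
Proof.
rewrite -[range unit]setCK; apply: open_closedC; apply: open_local => g.
move=> /range_unitP /(hausdorff_disjoint hG)[U [V [oU oV Uug Vg UV]]].
exists ((unit \o s) @^-1` U `&` V); split => //.
  apply: openI => //; apply: (preim_s (W := unit @^-1` U)).
  exact: open_preimage (@gunit_cont _ _ GG) oU.
by move=> h [/= Uh Vh] /range_unitP E; apply: UV Uh _; rewrite E.
Qed.

(** An arrow [k] near [mul g h] has the range of some [g'] in [U] near [g], as [r] is open. It
    factors as [g'] times [mul (inv g') k], and continuity of the product at [(inv g, mul g h)] puts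
    the second factor in [V]. *)
Lemma open_bisection_mul U V : open U -> open V -> open (bisection_mul U V).
Proof.
move=> oU oV; apply: open_local => _ [g [h [Ug Vh gh ->]]].
pose D := [set p : G * G | s p.1 = r p.2].
have Dgh : D (inv g, mul g h) by rewrite /D /= gs_inv gr_mul.
have nV : nbhs (mul (inv g) (mul g h)) V.
  by rewrite gmulKV//; exact: open_nbhs_nbhs.
have : nbhs_subspace (A := D) (inv g, mul g h) ((fun p => mul p.1 p.2) @^-1` V).
  exact: (@gmul_cont _ _ GG (inv g, mul g h) V nV).
rewrite -nbhs_subspace_in// => -[[N1 N2] /= [nN1 nN2] N12].
move: nN1; rewrite nbhsE => -[M1 [oM1 M1g] M1N].
move: nN2; rewrite nbhsE => -[M2 [oM2 M2g] M2N].
have oU' : open (U `&` inv @^-1` M1).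
  apply: openI => //.
  exact: open_preimage (@ginv_cont _ _ GG) _.
exists (M2 `&` r @^-1` (r @` (U `&` inv @^-1` M1))); split.
- by apply: openI => //; apply: preim_r; exact: local_homeo_open.
- by split=> //; exists g => //; rewrite gr_mul.
move=> k [/M2N N2k [g' [Ug' /M1N N1g'] gk]].
exists g', (mul (inv g') k); split => //.
- have /(_ _)/= : D (inv g', k) -> V (mul (inv g') k).
    by move=> Dk; have := N12 (inv g', k); apply.
  by apply; rewrite /D /= gs_inv.
- by rewrite gr_mul ?gr_inv// gs_inv.
- by rewrite gmulK.
Qed.

Lemma full_bisection_mul U V f h :
  full_bisection GG U -> full_bisection GG V -> is_pi GG U f -> is_pi GG V h ->
  full_bisection GG (bisection_mul U V) /\ is_pi GG (bisection_mul U V) (f \o h).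
Proof.
move=> fU fV pU pV; have bU := fU.1; have bV := fV.1; split; last first.
  move=> _ [u [v [Uu Vv uv ->]]] /=.
  by rewrite gs_mul// gr_mul// (pV v)// -uv (pU u).
apply: full_bisectionP.
- by apply: open_bisection_mul; [case: bU|case: bV].
- move=> _ _ [u [v [Uu Vv uv ->]]] [u' [v' [Uu' Vv' uv' ->]]].
  rewrite !gs_mul// => /(bisection_injs bV Vv Vv') E; move: uv' Vv'; rewrite -E => uv' _.
  by congr mul; apply: (bisection_injs bU) => //; rewrite uv.
- move=> _ _ [u [v [Uu Vv uv ->]]] [u' [v' [Uu' Vv' uv' ->]]].
  rewrite !gr_mul// => /(bisection_injr bU Uu Uu') E; move: uv' Uu'; rewrite -E => uv' _.
  by congr mul; apply: (bisection_injr bV) => //; rewrite -uv.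
- move=> x; have [v Vv <-] := full_bisections x fV.
  have [u Uu uv] := full_bisections (r v) fU.
  by exists (mul u v); [exists u, v|rewrite gs_mul].
- move=> x; have [u Uu <-] := full_bisectionr x fU.
  have [v Vv uv] := full_bisectionr (s u) fV.
  by exists (mul u v); [exists u, v|rewrite gr_mul].
Qed.

Lemma full_bisection_unit :
  full_bisection GG (range unit) /\ is_pi GG (range unit) id.
Proof.
split; last by move=> _ [x _ <-]; rewrite gs_unit gr_unit.
apply: full_bisectionP.
- exact: open_units.
- by move=> _ _ [x _ <-] [y _ <-]; rewrite !gs_unit => ->.
- by move=> _ _ [x _ <-] [y _ <-]; rewrite !gr_unit => ->.
- by move=> x; exists (unit x); rewrite ?gs_unit//; exists x.
- by move=> x; exists (unit x); rewrite ?gr_unit//; exists x.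
Qed.

Lemma pi_bijective U f : full_bisection GG U -> is_pi GG U f ->
  exists f', cancel f f' /\ cancel f' f.
Proof.
move=> fU pU; have bU := fU.1.
have /choice[f' f'K] : forall y, exists x, f x = y.
  by move=> y; have [u Uu <-] := full_bisectionr y fU; exists (s u); exact: pU.
exists f'; split => // x; have := f'K (f x).
have [u Uu <-] := full_bisections x fU.
have [v Vv <-] := full_bisections (f' (f (s u))) fU.
by rewrite (pU u)// (pU v)// => /(bisection_injr bU Vv Uu) ->.
Qed.

Lemma compact_support_sub (f : X -> X) K :
  compact K -> (forall x, f x <> x -> K x) -> compact (supp f).
Proof.
move=> cK fK; apply: (subclosed_compact _ cK); first exact: closed_support.
by apply: support_sub => //; exact: compact_closed.
Qed.

Lemma full_group_transformation_group : transformation_group (full_group GG).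
Proof.
split.
- have [fU pU] := full_bisection_unit; exists (range unit); split => //.
  by apply: (@compact_support_sub id set0) => //; exact: compact0.
- move=> f h [U [fU pU cf]] [V [fV pV ch]].
  have [fUV pUV] := full_bisection_mul fU fV pU pV.
  exists (bisection_mul U V); split => //.
  apply: (compact_support_sub (compactU cf ch)) => x /= fhx.
  have [hx|/in_support] := pselect (h x = x); last by right.
  by left; apply: in_support => fx; apply: fhx; rewrite hx.
- move=> f [U [fU pU cf]]; have [f' [fK f'K]] := pi_bijective fU pU.
  have [fU' pU'] := full_bisection_inv fU pU fK.
  exists f'; split => //; exists (inv @^-1` U); split => //.
  apply: (compact_support_sub cf) => x f'x; apply: in_support => fx.
  by apply: f'x; rewrite -{1}fx fK.
Qed.

Lemma full_group_continuous f : full_group GG f -> continuous f.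
Proof.
move=> [U [fU pU _]]; apply/continuousP => W oW.
have [oU _] := fU.1.
rewrite (_ : f @^-1` W = s @` (U `&` r @^-1` W)).
  by apply: local_homeo_open => //; apply: openI => //; exact: preim_r.
apply/seteqP; split=> [x /= Wfx|_ [u [Uu Wu] <-]] /=; last by rewrite (pU u).
have [u Uu ux] := full_bisections x fU.
by exists u => //; split => //=; rewrite -(pU u)// ux.
Qed.

(* By effectiveness the support of the homeomorphism of U is the source of
   U minus the units, which is open as the units are closed, G being Hausdorff. *)
Lemma full_group_support_open f : full_group GG f -> open (supp f).
Proof.
move=> [U [fU pU _]]; have bU := fU.1; have [oU _] := bU.
have oUu : open (U `&` ~` range unit).
  by apply: openI => //; exact/closed_openC/closed_units.
rewrite (_ : supp f = s @` (U `&` ~` range unit)); first exact: local_homeo_open.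
apply/seteqP; split.
  apply: support_sub => [|x].
    (* The sources of the units in [U] form an open set, and it is the complement because [s] is
       bijective on [U]. *)
    rewrite (_ : s @` _ = ~` (s @` (U `&` range unit))).
      apply: open_closedC; apply: local_homeo_open => //; apply: openI => //.
      exact: open_units.
    apply/seteqP; split=> [_ [u [Uu nu] <-] [v [Uv vu] E]|x nx].
      by apply: nu; rewrite -(bisection_injs bU Uv Uu E).
    have [u Uu ux] := full_bisections x fU; exists u => //; split => // uu.
    by apply: nx; exists u.
  have [u Uu <-] := full_bisections x fU; rewrite (pU u)// => ru.
  by exists u => //; split => // -[y _ E]; apply: ru; rewrite -E gs_unit gr_unit.
(* Without moved points near [s u], a neighbourhood of [u] in [U] would consist of isotropy, and
   effectiveness would make [u] a unit. *)
move=> _ [u [Uu nu] <-] B; rewrite nbhsE => -[W [oW Wu] WB].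
apply: contrapT => nm; apply: nu; rewrite -effG.
rewrite /interior nbhsE; exists (U `&` s @^-1` W); first split => //.
  by apply: openI => //; exact: preim_s.
move=> v [Uv Wv] /=; apply: contrapT => svr; apply: nm.
exists (s v); split; last exact: WB.
by apply/eqP; rewrite (pU v)//; exact/nesym.
Qed.

(** A small bisection [V] around [g] has compact open source [K] in [O] and compact range [L] in
    [O']. Joining [V], its inverse and the units off [K] and [L] gives a full bisection stable under
    inversion, which exchanges [K] and [L]. *)
Lemma swap_involution g O O' : open O -> open O' -> (forall x, O x -> ~ O' x) ->
  O (s g) -> O' (r g) ->
  exists U t, [/\ full_bisection GG U /\ U g, is_pi GG U t, full_group GG t,
                  involutive t & supp t `<=` O `|` O'].
Proof.
move=> oO oO' OO' Og O'g.
have [_ /(_ g)[U1 [oU1 U1g rI _]]] := lhr.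
have [_ /(_ g)[U2 [oU2 U2g sI _]]] := lhs.
pose V0 := U1 `&` U2 `&` (s @^-1` O `&` r @^-1` O').
have oV0 : open V0.
  by apply: openI; apply: openI => //; [exact: preim_s|exact: preim_r].
have [|K [cK oK Kg KV0]] := cobX (local_homeo_open lhs oV0) (_ : (s @` V0) (s g)).
  by exists g.
pose V := V0 `&` s @^-1` K.
have oV : open V by apply: openI => //; exact: preim_s.
have Vg : V g by [].
have sVI u v : V u -> V v -> s u = s v -> u = v.
  by move=> [[[_ U2u] _] _] [[[_ U2v] _] _]; apply: sI; rewrite inE.
have rVI u v : V u -> V v -> r u = r v -> u = v.
  by move=> [[[U1u _] _] _] [[[U1v _] _] _]; apply: rI; rewrite inE.
have KV x : K x -> exists2 v, V v & s v = x.
  by move=> Kx; have [v V0v vx] := KV0 _ Kx; exists v => //; split => //=; rewrite vx.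
have VK v : V v -> K (s v) by move=> [].
pose L := r @` V.
have KO x : K x -> O x by move=> /KV[v [[_ [+ _]] _] <-].
have LO' x : L x -> O' x by move=> [v [[_ [_ +]] _] <-].
have KL x : K x -> ~ L x by move=> /KO Ox /LO'; exact: OO'.
(* [L] is the image of [K] under [r] after the section of [s] into [V]. Off [K] the section takes
   the default value [g]. *)
have cL : compact L.
  have /choice[sec secP] : forall x, exists v, K x -> V v /\ s v = x.
    move=> x; have [/KV[v Vv vx]|nK] := pselect (K x); first by exists v.
    by exists g.
  have -> : L = (r \o sec) @` K.
    apply/seteqP; split=> [_ [v Vv <-]|_ [x Kx <-]].
      exists (s v); first exact: VK.
      by have [Vsec E] := secP _ (VK _ Vv) => /=; rewrite (sVI _ v Vsec Vv E).
    by exists (sec x) => //; have [] := secP _ Kx.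
  apply: continuous_compact => //.
  rewrite continuous_open_subspace//; apply/continuous_inP => // W oW.
  rewrite (_ : K `&` _ = s @` (V `&` r @^-1` W)).
    by apply: local_homeo_open => //; apply: openI => //; exact: preim_r.
  apply/seteqP; split=> [x [Kx Wx]|_ [v [Vv Wv] <-]].
    by have [Vx sx] := secP _ Kx; exists (sec x).
  split; first exact: VK.
  by have [Vsec E] := secP _ (VK _ Vv) => /=; rewrite (sVI _ v Vsec Vv E).
have cKL : compact (K `|` L) by exact: compactU.
have clKL : closed (K `|` L) by exact: compact_closed.
pose U := V `|` inv @^-1` V `|` (range unit `&` s @^-1` ~` (K `|` L)).
have Uinv u : U u -> U (inv u).
  move=> [[Vu|Vu]|[[x _ <-] nu]].
  - by left; right; rewrite /= ginvK.
  - by left; left.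
  - by right; rewrite ginv_unit; split => //; exists x.
have oU : open U.
  apply: openU; first apply: openU => //.
    exact: open_preimage (@ginv_cont _ _ GG) _.
  apply: openI; first exact: open_units.
  exact/preim_s/closed_openC.
have UsI u v : U u -> U v -> s u = s v -> u = v.
  have VL w : V (inv w) -> L (s w) by move=> Vw; exists (inv w) => //; rewrite gr_inv.
  move=> [[Vu|Vu]|[/range_unitP Eu nu]] [[Vv|Vv]|[/range_unitP Ev nv]] E.
  - exact: sVI.
  - by case: (KL (s u)); [exact: VK|rewrite E; exact: VL].
  - by case: nv; left; rewrite /= -E; exact: VK.
  - by case: (KL (s v)); [exact: VK|rewrite -E; exact: VL].
  - by apply: (can_inj ginvK); apply: rVI => //; rewrite !gr_inv.
  - by case: nv; right; rewrite /= -E; exact: VL.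
  - by case: nu; left; rewrite /= E; exact: VK.
  - by case: nu; right; rewrite /= E; exact: VL.
  - by rewrite -Eu -Ev E.
have UsT x : exists2 u, U u & s u = x.
  have [/KV[v Vv vx]|nK] := pselect (K x); first by exists v => //; left; left.
  have [[v Vv vx]|nL] := pselect (L x).
    by exists (inv v); rewrite ?gs_inv//; left; right; rewrite /= ginvK.
  exists (unit x); rewrite ?gs_unit//; right; split; first by exists x.
  by rewrite /= gs_unit => -[].
have fU : full_bisection GG U.
  apply: full_bisectionP => //.
    move=> u v /Uinv Uu /Uinv Uv E; apply: (can_inj ginvK); apply: UsI => //.
    by rewrite !gs_inv.
  by move=> x; have [u /Uinv Uu ux] := UsT x; exists (inv u) => //; rewrite gr_inv.
have [t pt] := full_bisection_pi fU.
have tKL x : t x <> x -> (K `|` L) x.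
  move=> tx; have [u Uu ux] := UsT x; case: (Uu) => [[Vu|Vu]|[[y _ uE] _]].
  - by left; rewrite -ux; exact: VK.
  - by right; exists (inv u) => //; rewrite gr_inv.
  - by case: tx; rewrite -ux pt// -uE gr_unit gs_unit.
have cst : compact (supp t) by exact: compact_support_sub tKL.
exists U, t; split => //.
- by split => //; left; left.
- by exists U.
- move=> x; have [u Uu <-] := UsT x; rewrite pt// -gs_inv pt; first by rewrite gr_inv.
  exact: Uinv.
- apply: (@subset_trans _ (K `|` L)); first exact: support_sub.
  by move=> x [/KO|/LO']; [left|right].
Qed.

Lemma orbitP x y : Defs.orbit GG x y <-> exists g, s g = x /\ r g = y.
Proof.
by split=> [[g gx <-]|[g [gx gy]]]; [exists g|exists g].
Qed.

Lemma full_group_locally_moving : locally_moving (full_group GG).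
Proof.
split.
- exact: full_group_transformation_group.
- exact: hX.
- exact: full_group_continuous.
- exact: full_group_support_open.
- by move=> f [U []].
- move=> W oW [w Ww]; have [K [cK oK Kw KW]] := cobX oW Ww.
  have [_ _ _ _ [_ two]] := stG.
  have [| | |x [y [z [Ky Kz yz /orbitP[g [gx gy]] /orbitP[h [hx hz]]]]]] := two K.
  + by exists w.
  + by [].
  + exact: compact_closed.
  have [M [M' [oO oO' Oy M'z MM']]] := hausdorff_disjoint hX yz.
  (* The arrow [mul h (inv g)] runs from [y] to [z], both in [K], so the swap takes place inside
     [W]. *)
  have gh : s h = r (inv g) by rewrite gr_inv gx hx.
  have [| | | | |U [t [[fU Uk] pt At tt tO]]] :=
    @swap_involution (mul h (inv g)) (M `&` K) (M' `&` K).
  + exact: openI.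
  + exact: openI.
  + by move=> v [Ov _] [/(MM' v Ov)].
  + by rewrite gs_mul// gs_inv gy.
  + by rewrite gr_mul// hz.
  exists t; split => //.
    move=> E; apply: yz; have := pt _ Uk.
    by rewrite gs_mul// gr_mul// gs_inv gy hz E.
  by move=> v /in_support /tO[][_ /KW].
move=> x W oW Wx; have [_ _ _ _ [/(_ x) three _]] := stG.
have [y [z [xy xz nyx nzx yz]]] : exists y z,
    [/\ Defs.orbit GG x y, Defs.orbit GG x z, x <> y, x <> z & y <> z].
  have [a [b [c [oa ob oc [ab ac bc]]]]] := three.
  have [xa|xa] := pselect (x = a); first by exists b, c; split => //; rewrite xa.
  have [xb|xb] := pselect (x = b).
    by exists a, c; split => //; rewrite xb.
  by exists a, b.
have /orbitP[g [gx gy]] := xy; have /orbitP[h [hx hz]] := xz.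
have [M1 [P1 [oO1 oP1 O1x P1y OP1]]] := hausdorff_disjoint hX nyx.
have [M2 [P2 [oO2 oP2 O2x P2z OP2]]] := hausdorff_disjoint hX nzx.
(* One involution swaps a part of [N] around [x] with a set near [y], the other with a set near [z].
   As [Q1] and [Q2] are disjoint, the supports can meet only in [N]. *)
have [Q1 [Q2 [oQ1 oQ2 Q1y Q2z Q12]]] := hausdorff_disjoint hX yz.
pose N := W `&` (M1 `&` M2).
have oN : open N by do 2?[apply: openI => //].
have Nx : N x by [].
have [| | | |U [t [[fU Ug] pt At tt tO]]] := @swap_involution g N (P1 `&` Q1) oN.
- exact: openI.
- by move=> v [_ [M1v _]] [/(OP1 v M1v)].
- by rewrite gx.
- by rewrite gy.
have [| | | |U' [t' [[fU' Uh] pt' At' tt' tO']]] := @swap_involution h N (P2 `&` Q2) oN.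
- exact: openI.
- by move=> v [_ [_ M2v]] [/(OP2 v M2v)].
- by rewrite hx.
- by rewrite hz.
exists t, t'; split => //.
- by apply: in_support; rewrite -gx pt// gx gy; exact: nesym.
- by apply: in_support; rewrite -hx pt'// hx hz; exact: nesym.
- move=> v [/tO[[]//|[_ Q1v]] /tO'[[]//|[_ Q2v]]].
  by case: (Q12 v Q1v Q2v).
Qed.

(** A non-isotropy arrow lies in a swapping bisection. An isotropy arrow [g] is the product of
    [mul g (inv h)] and [h], where [h] leads from [s g] to another point of its orbit; neither
    factor is isotropy. *)
Lemma arrow_in_full_bisection g : exists U f,
  [/\ full_bisection GG U, U g, is_pi GG U f & full_group GG f].
Proof.
have offdiag k : s k <> r k -> exists U f,
    [/\ full_bisection GG U, U k, is_pi GG U f & full_group GG f].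
  move=> /(hausdorff_disjoint hX)[M [M' [oO oO' Ok M'k MM']]].
  have [U [t [[fU Uk] pt At _ _]]] := swap_involution oO oO' MM' Ok M'k.
  by exists U, t.
have [sr|] := pselect (s g = r g); last exact: offdiag.
have [_ _ _ _ [/(_ (s g)) three _]] := stG.
have [h [hg nh]] : exists h, s h = s g /\ r h <> s g.
  have [a [b [_ [/orbitP[h1 [h1g h1a]] /orbitP[h2 [h2g h2b]] _ [ab _ _]]]]] := three.
  have [E|nE] := pselect (r h1 = s g); last by exists h1.
  by exists h2; split => // E'; apply: ab; rewrite -h1a -h2b E E'.
have [|U [f [fU Uk pf Af]]] := offdiag (mul g (inv h)).
- by rewrite gs_mul ?gr_inv// gr_mul ?gr_inv// gs_inv -sr.
have [|V [f' [fV Vh pf' Af']]] := offdiag h; first by rewrite hg; exact: nesym.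
have [fUV pUV] := full_bisection_mul fU fV pf pf'.
exists (bisection_mul U V), (f \o f'); split => //.
- exists (mul g (inv h)), h; split => //; last by rewrite gmulVK.
  by rewrite gs_mul ?gr_inv// gs_inv.
- exact: (tg_comp full_group_transformation_group).
Qed.

(* The quotient of the two bisections over W consists of isotropy, hence of
   units by effectiveness. *)
Lemma bisection_germ_unique U V f h W u v :
  full_bisection GG U -> full_bisection GG V -> is_pi GG U f -> is_pi GG V h ->
  open W -> W (s u) -> (forall x, W x -> f x = h x) ->
  U u -> V v -> s u = s v -> u = v.
Proof.
move=> fU fV pU pV oW Wu fh Uu Vv uv.
have [f' [fK f'K]] := pi_bijective fU pU.
have [fU' pU'] := full_bisection_inv fU pU fK.
have [[oQ _] pQ] := full_bisection_mul fU' fV pU' pV.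
have ruv : r u = r v by rewrite -(pU u)// -(pV v)// -uv fh.
have c : s (inv u) = r v by rewrite gs_inv.
set Q := bisection_mul _ _ in oQ pQ *.
have : (interior [set g | s g = r g]) (mul (inv u) v).
  rewrite /interior nbhsE; exists (Q `&` s @^-1` W); first split.
  - by apply: openI; [case: oQ|exact: preim_s].
  - split; last by rewrite /= gs_mul// -uv.
    by exists (inv u), v; split => //=; rewrite ginvK.
  by move=> k [Qk Wk] /=; rewrite -(pQ k Qk) /= -fh// fK.
rewrite effG => /range_unitP; rewrite gs_mul// => E.
have := gmulK ruv; rewrite -E -uv.
by rewrite gmul_unitr.
Qed.

End Bisections.

(** * The groupoid of germs *)

(* The graph of the isomorphism induced by phi: [g] and [g'] lie in full
   bisections whose homeomorphisms are conjugate under phi. *)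
Definition conjugate_arrows (G1 X1 G2 X2 : topologicalType)
    (GG1 : groupoid G1 X1) (GG2 : groupoid G2 X2) (phi : X1 -> X2) (psi : X2 -> X1)
    (g : G1) (g' : G2) : Prop :=
  exists U U' f, [/\ full_bisection GG1 U /\ U g, is_pi GG1 U f,
    full_bisection GG2 U' /\ U' g', is_pi GG2 U' (phi \o f \o psi) &
    gs GG2 g' = phi (gs GG1 g)].

Lemma conjugate_arrows_sym (G1 X1 G2 X2 : topologicalType)
    (GG1 : groupoid G1 X1) (GG2 : groupoid G2 X2) phi psi g g' :
  cancel phi psi -> cancel psi phi ->
  conjugate_arrows GG1 GG2 phi psi g g' -> conjugate_arrows GG2 GG1 psi phi g' g.
Proof.
move=> phiK psiK [U [U' [f [fU pU fU' pU' sg]]]].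
exists U', U, (phi \o f \o psi); split => //; last by rewrite sg phiK.
by move=> h Uh; rewrite /= !phiK pU.
Qed.

Section SpatialReconstruction.
Variables (G1 X1 G2 X2 : topologicalType).
Variables (GG1 : groupoid G1 X1) (GG2 : groupoid G2 X2).
Hypotheses (st1 : standing GG1) (st2 : standing GG2).
Variables (phi : X1 -> X2) (psi : X2 -> X1).
Hypothesis phiK : cancel phi psi.
Hypotheses (phi_cont : continuous phi) (psi_cont : continuous psi).
Hypothesis phi_conj : forall f, full_group GG1 f -> full_group GG2 (phi \o f \o psi).

Local Notation conj_arrows := (conjugate_arrows GG1 GG2 phi psi).

Lemma conjugate_arrows_total g : exists g', conj_arrows g g'.
Proof.
have [U [f [fU Ug pU /phi_conj[U' [fU' pU' _]]]]] := arrow_in_full_bisection st1 g.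
have [g' Ug' sg'] := full_bisections (phi (gs GG1 g)) fU'.
by exists g', U, U', f.
Qed.

(** The homeomorphisms of two bisections through [g] agree near [s g], so their conjugates agree
    near [phi (s g)], and a germ determines its arrow. *)
Lemma conjugate_arrows_functional g g1 g2 :
  conj_arrows g g1 -> conj_arrows g g2 -> g1 = g2.
Proof.
move=> [U [U' [f [[fU Ug] pU [fU' Ug1] pU' sg1]]]].
move=> [V [V' [h [[fV Vg] pV [fV' Vg2] pV' sg2]]]].
have [[oU _] _] := fU; have [[oV _] _] := fV.
have [_ [[_ lhs] _] _ _ _] := st1.
apply: (bisection_germ_unique st2 fU' fV' pU' pV'
         (W := psi @^-1` (gs GG1 @` (U `&` V)))).
- by apply: open_preimage => //; apply: local_homeo_open => //; exact: openI.
- by rewrite sg1 /= phiK; exists g.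
- by move=> x [k [Uk Vk] kx] /=; rewrite -kx pU// pV.
- by [].
- by [].
- by rewrite sg1 sg2.
Qed.

Lemma conjugate_arrows_range g g' : conj_arrows g g' -> gr GG2 g' = phi (gr GG1 g).
Proof.
move=> [U [U' [f [[fU Ug] pU [fU' Ug'] pU' sg]]]].
by rewrite -(pU' _ Ug') -(pU _ Ug) sg /= phiK.
Qed.

Lemma conjugate_arrows_mul g g' h h' : gs GG1 g = gr GG1 h ->
  conj_arrows g g' -> conj_arrows h h' ->
  conj_arrows (gmul GG1 g h) (gmul GG2 g' h').
Proof.
move=> gh Rg Rh; have rh := conjugate_arrows_range Rh; move: Rg Rh.
move=> [U [U' [f [[fU Ug] pU [fU' Ug'] pU' sg]]]].
move=> [V [V' [k [[fV Vh] pV [fV' Vh'] pV' sh]]]].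
have gh' : gs GG2 g' = gr GG2 h' by rewrite sg gh rh.
have [fUV pUV] := full_bisection_mul st1 fU fV pU pV.
have [fUV' pUV'] := full_bisection_mul st2 fU' fV' pU' pV'.
exists (bisection_mul GG1 U V), (bisection_mul GG2 U' V'), (f \o k).
split => //; [by split => //; exists g, h|by split => //; exists g', h'| |].
  by move=> x /pUV' <- /=; rewrite phiK.
by rewrite !gs_mul.
Qed.

(** Near [g], the map [F] is the source map followed by [phi] and by the inverse of the source map
    on [U']. *)
Lemma conjugate_arrows_continuous F : (forall g, conj_arrows g (F g)) -> continuous F.
Proof.
move=> RF; apply/continuousP => W oW; apply: open_local => g /= WFg.
have [U [U' [f [[fU Ug] pU [fU' Ug'] pU' sg]]]] := RF g.
have [[oU _] _] := fU; have [[oU' _] _] := fU'.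
have [_ [[_ lhs] _] _ _ _] := st2.
have oW' : open (gs GG2 @` (U' `&` W)) by apply: local_homeo_open => //; exact: openI.
exists (U `&` gs GG1 @^-1` (phi @^-1` (gs GG2 @` (U' `&` W)))); split.
- apply: openI => //; apply: open_preimage; first exact: gs_cont.
  exact: open_preimage.
- by split => //; exists (F g).
move=> k [Uk [u [Uu Wu] uk]] /=.
by rewrite (conjugate_arrows_functional (RF k) (_ : conj_arrows k u))//; exists U, U', f.
Qed.

End SpatialReconstruction.

(** The conjugacy relation is total and functional in both directions and symmetric, so its two
    choice functions are mutually inverse. *)
Lemma spatial_groupoid_isomorphic (G1 X1 G2 X2 : topologicalType)
    (GG1 : groupoid G1 X1) (GG2 : groupoid G2 X2) phi psi :
  standing GG1 -> standing GG2 -> cancel phi psi -> cancel psi phi ->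
  continuous phi -> continuous psi ->
  (forall f, full_group GG1 f -> full_group GG2 (phi \o f \o psi)) ->
  (forall f, full_group GG2 f -> full_group GG1 (psi \o f \o phi)) ->
  groupoid_isomorphic GG1 GG2.
Proof.
move=> st1 st2 phiK psiK cphi cpsi conj1 conj2.
have /choice[F RF] := conjugate_arrows_total st1 conj1.
have /choice[F' RF'] := conjugate_arrows_total st2 conj2.
exists F, phi; split.
- exists F'; split.
  + move=> g; apply: (conjugate_arrows_functional st2 st1 psiK cphi (RF' _)).
    exact: conjugate_arrows_sym (RF g).
  + move=> g; apply: (conjugate_arrows_functional st1 st2 phiK cpsi (RF _)).
    exact: conjugate_arrows_sym (RF' g).
  + exact: (conjugate_arrows_continuous st1 st2 phiK cphi cpsi RF).
  + exact: (conjugate_arrows_continuous st2 st1 psiK cpsi cphi RF').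
- by exists psi.
- by move=> g; have [U [U' [f []]]] := RF g.
- by move=> g; exact: (conjugate_arrows_range phiK (RF g)).
move=> g h gh; apply: (conjugate_arrows_functional st1 st2 phiK cpsi (RF _)).
exact: conjugate_arrows_mul.
Qed.

(** * Full groups of isomorphic groupoids *)

Lemma full_group_conj (G1 X1 G2 X2 : topologicalType)
    (GG1 : groupoid G1 X1) (GG2 : groupoid G2 X2)
    (F : G1 -> G2) (F' : G2 -> G1) (f : X1 -> X2) (f' : X2 -> X1) a :
  hausdorff_space X2 -> cancel F F' -> cancel F' F -> continuous F' ->
  cancel f f' -> cancel f' f -> continuous f ->
  (forall g, gs GG2 (F g) = f (gs GG1 g)) ->
  (forall g, gr GG2 (F g) = f (gr GG1 g)) ->
  full_group GG1 a -> full_group GG2 (f \o a \o f').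
Proof.
move=> hX2 FK F'K cF' fK f'K cf Fs Fr [U [fU pU ca]].
have bU := fU.1; have [oU _] := bU.
have Fs' g : gs GG1 (F' g) = f' (gs GG2 g) by rewrite -{2}(F'K g) Fs fK.
have Fr' g : gr GG1 (F' g) = f' (gr GG2 g) by rewrite -{2}(F'K g) Fr fK.
(* This is the image of [U] under [F], in a form whose openness follows from continuity of [F']. *)
exists (F' @^-1` U); split.
- apply: full_bisectionP.
  + exact: open_preimage.
  + move=> g h Ug Uh gh; apply: (can_inj F'K).
    by apply: (bisection_injs bU Ug Uh); rewrite !Fs' gh.
  + move=> g h Ug Uh gh; apply: (can_inj F'K).
    by apply: (bisection_injr bU Ug Uh); rewrite !Fr' gh.
  + move=> x; have [u Uu ux] := full_bisections (f' x) fU.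
    by exists (F u); rewrite /= ?FK// Fs ux f'K.
  + move=> x; have [u Uu ux] := full_bisectionr (f' x) fU.
    by exists (F u); rewrite /= ?FK// Fr ux f'K.
- by move=> g Ug /=; rewrite -Fs' (pU _ Ug) Fr' f'K.
have cfa : compact (f @` supp a).
  by apply: continuous_compact => //; exact: continuous_subspaceT.
apply: (subclosed_compact _ cfa); first exact: closed_support.
apply: support_sub => [|x fax]; first exact: compact_closed.
exists (f' x) => //; apply: in_support => E; apply: fax.
by rewrite /= E f'K.
Qed.

Lemma groupoid_isomorphic_full_groups (G1 X1 G2 X2 : topologicalType)
    (GG1 : groupoid G1 X1) (GG2 : groupoid G2 X2) :
  hausdorff_space X1 -> hausdorff_space X2 ->
  groupoid_isomorphic GG1 GG2 -> full_groups_isomorphic GG1 GG2.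
Proof.
move=> h1 h2 [F [f [[F' [FK F'K cF cF']] [f' [fK f'K cf cf']] Fs Fr _]]].
have Fs' g : gs GG1 (F' g) = f' (gs GG2 g) by rewrite -{2}(F'K g) Fs fK.
have Fr' g : gr GG1 (F' g) = f' (gr GG2 g) by rewrite -{2}(F'K g) Fr fK.
exists (fun a => f \o a \o f'); split.
- by move=> a; apply: (full_group_conj h2 FK).
- move=> a b _ _ /(congr1 (fun c => f' \o c \o f)) E; apply/funext => x.
  by have /= := congr1 (@^~ x) E; rewrite !fK.
- move=> b Ab; exists (f' \o b \o f).
    exact: (full_group_conj h1 F'K FK cF f'K fK cf' Fs' Fr').
  by apply/funext => x /=; rewrite !f'K.
by move=> a b _ _; apply/funext => x /=; rewrite fK.
Qed.

Theorem theorem7p8 (G1 X1 G2 X2 : topologicalType)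
  (GG1 : groupoid G1 X1) (GG2 : groupoid G2 X2) :
  standing GG1 -> standing GG2 ->
  (forall Phi, full_group_iso GG1 GG2 Phi -> spatial GG1 GG2 Phi) /\
  (groupoid_isomorphic GG1 GG2 <-> full_groups_isomorphic GG1 GG2).
Proof.
move=> st1 st2.
have lm1 := full_group_locally_moving st1; have lm2 := full_group_locally_moving st2.
have spat Phi : full_group_iso GG1 GG2 Phi -> spatial GG1 GG2 Phi.
  exact: locally_moving_spatial lm1 lm2.
split=> //; split.
  exact: groupoid_isomorphic_full_groups (lm_hausdorff lm1) (lm_hausdorff lm2).
move=> [Phi iso]; have [phi [psi [phiK psiK cphi cpsi PhiE]]] := spat Phi iso.
have [inPhi _ surj _] := iso.
apply: (spatial_groupoid_isomorphic st1 st2 phiK psiK cphi cpsi).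
  by move=> f Af; rewrite -PhiE//; exact: inPhi.
(* Every element of the second full group is some [Phi a], and conjugating it back by [psi] returns
   [a]. *)
move=> _ /surj[a Aa <-]; rewrite PhiE//.
suff -> : psi \o (phi \o a \o psi) \o phi = a by [].
by apply/funext => x /=; rewrite !phiK.
Qed.
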